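(* Let $\kappa \geq \omega$ be a cardinal and let $\mathbb{S}$ be a $\kappa^{+}$-Suslin tree such that for each $s \in \mathbb{S}$ the set $\mathrm{succ}(s) = \{t \in \mathbb{S} : t \geq s \text{ and } \mathrm{ht}(t) = \mathrm{ht}(s)+1\}$ has size exactly $\kappa$, and $|\{t \in \mathbb{S} : t \geq s\}| = \kappa^{+}$. Let $\lambda = \log_{\kappa}(\kappa^{+})$. Then there is a coloring $c : \mathbb{S}^{[2]} \to 2$ such that: (1) there is no $X \subset \mathbb{S}$ with $|X| = \kappa^{+}$ and $X^{[2]} \subset K_0$; (2) there is no $s \in \mathbb{S}$ and $B \subset \mathrm{pred}(s)$ such that $B$ has order type $\lambda + 2$ (in the tree order) and $B^{[2]} \subset K_1$.
   Context: $\log_{\kappa}(\kappa^{+}) = \min\{\lambda : \kappa^{\lambda} > \kappa\}$. A $\kappa^{+}$-Suslin tree is a tree of size $\kappa^{+}$ with no chains and no antichains of size $\kappa^{+}$; $\mathrm{ht}$ denotes height in the tree and $\mathrm{pred}(s) = \{t \in \mathbb{S} : t < s\}$. For $Y \subset \mathbb{S}$, $Y^{[2]} = \{\{a,b\} \subset Y : a < b\}$ is the set of comparable pairs from $Y$. For the coloring $c$, $K_0 = \{p \in \mathbb{S}^{[2]} : c(p) = 0\}$ and $K_1 = \{p \in \mathbb{S}^{[2]}: c(p)=1\}$. *)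

(* Defs.v *)
From mathcomp Require Import all_boot all_order.
From mathcomp Require Import boolp classical_sets functions cardinality wochoice.

Set Implicit Arguments.
Unset Strict Implicit.
Unset Printing Implicit Defensive.

Local Open Scope classical_set_scope.
Local Open Scope card_scope.
Local Open Scope order_scope.

(* Cardinal numbers are represented by types, up to bijection. *)

Definition card_lt (T U : Type) (A : set T) (B : set U) : Prop :=
  A #<= B /\ ~ (B #<= A).

Definition is_succ_card (K Kp : Type) : Prop :=
  card_lt [set: K] [set: Kp] /\
  forall M : Type, card_lt [set: K] [set: M] -> [set: Kp] #<= [set: M].

(* L represents log_K (K^+) = min { M : K ^ M > K }. *)
Definition is_log_succ (K L : Type) : Prop :=
  card_lt [set: K] [set: L -> K] /\
  forall M : Type, card_lt [set: K] [set: M -> K] -> [set: L] #<= [set: M].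

(* Ordinal numbers are represented by (non-strict) well-orders, up to order
   isomorphism. *)

Definition same_order_type (A B : Type) (r : rel A) (q : rel B) : Prop :=
  exists2 f : A -> B, bijective f & {mono f : x y / r x y >-> q x y}.

(* The order r + n: an increasing chain of n new elements placed above r. *)
Definition ord_add (A : Type) (r : rel A) (n : nat) : rel (A + 'I_n) :=
  fun u v => match u, v with
  | inl x, inl y => r x y
  | inl _, inr _ => true
  | inr _, inl _ => false
  | inr i, inr j => (i <= j)%N
  end.
Arguments ord_add {A} r n.

(* L is a cardinal in the sense of an initial ordinal: a well-order that has
   no proper initial segment of its own cardinality. *)
Definition initial_ordinal (d : Order.disp_t) (L : orderType d) : Prop :=
  well_order (<=%O : rel L) /\
  forall x : L, ~ ([set: L] #<= [set y : L | y < x]).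

Section Trees.
Context {d : Order.disp_t} {S : porderType d}.
Implicit Types (s t : S) (X Y : set S).

Definition tree_pred s : set S := [set t | t < s].

Definition tree_cone s : set S := [set t | s <= t].

Definition set_le Y : rel Y := fun x y => val x <= val y.
Arguments set_le : clear implicits.

Definition is_tree : Prop :=
  forall s, wo_chain (<=%O : rel S) (mem (tree_pred s)).

Definition ht s : rel (tree_pred s) := set_le (tree_pred s).
Arguments ht : clear implicits.

Definition tree_succ s : set S :=
  [set t | s <= t /\ same_order_type (ht t) (ord_add (ht s) 1)].

Definition is_chain X : Prop := chain (<=%O : rel S) (mem X).

Definition is_antichain X : Prop :=
  forall x y, X x -> X y -> x <> y -> ~~ (x >=< y).

(* Y^[2], as a set of unordered pairs *)
Definition comparable_pairs Y : set (set S) :=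
  [set p | exists a b, [/\ Y a, Y b, a < b & p = [set a; b]]].

Definition color_class (c : comparable_pairs [set: S] -> 'I_2) (i : nat) :
    set (set S) :=
  [set val p | p in [set p : comparable_pairs [set: S] | c p = i :> nat]].

End Trees.

Arguments is_tree {d} S.
Arguments set_le {d S} Y.
Arguments ht {d S} s.

(* With Kp = kappa^+, a kappa^+-Suslin tree. *)
Definition suslin_tree (Kp : Type) (d : Order.disp_t) (S : porderType d) :
    Prop :=
  [/\ is_tree S,
      [set: S] #= [set: Kp],
      (forall X : set S, is_chain X -> ~ (X #= [set: Kp])) &
      (forall X : set S, is_antichain X -> ~ (X #= [set: Kp]))].

(* Main.v *)
(** Fix distinct [r_s : L -> K] for [s] in [S], and label the immediate
    successors of every node by the bounded initial segments of elements of
    [L -> K]: there are only [K] many of these, by minimality of [L].  Put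
    [c {a < b} = 1] when the successor of [a] below [b] carries a label [p]
    that is an initial segment of [r_b] but not of [r_a].

    If [x_0 < x_1 < ... < y_0 < y_1] is homogeneous of colour 1, then the label
    [p_n] of the successor of [x_n] below [y_1] is a common initial segment of
    [r_(y_0)] and [r_(y_1)], and of [r_(x_m)] for [m > n], whereas [p_m] is not
    an initial segment of [r_(x_m)].  So [n |-> p_n] injects [L] into a proper
    initial segment of [L].

    If [X] has size [K^+], consider for each label [p] the upward closed set
    [D_p] of those [s] with no [t >= s] in [X] such that [r_t] extends [p].  The
    minimal elements of [D_p] form an antichain, so there are at most [K] of
    them over all [p], and some [s] in [X] is below none of them and has some
    [t > s] in [X].  Let [p] be an initial segment of [r_t] but not of [r_s].
    As [s] is not in [D_p] and lies below no minimal element of [D_p], the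
    successor of [s] labelled [p] is not in [D_p] either, which yields [t'] in
    [X] with [c {s < t'} = 1]. *)
Require Import Defs.
From mathcomp Require Import all_boot all_order.
From mathcomp Require Import boolp classical_sets functions cardinality wochoice.

Import Order.TTheory.
Local Open Scope classical_set_scope.
Local Open Scope card_scope.

(** * Comparison of cardinals and infinite cardinal arithmetic *)

Lemma card_le_typeP (T U : Type) :
  [set: T] #<= [set: U] <-> exists f : T -> U, injective f.
Proof.
split=> [/card_leP[f]|[f f_inj]].
  exists (fun x => val (f (SigSub (mem_set (I : [set: T] x))))) => x y /val_inj.
  by move=> /inj; rewrite !inE => /(_ I I) /(congr1 val).
have/injfunPex :
    exists2 g : T -> U, set_fun [set: T] [set: U] g & set_inj setT g.
  by exists f => // x y _ _; apply: f_inj.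
by case=> g; apply: inj_card_le g.
Qed.

Lemma card_le_setP (T U : Type) (u0 : U) (A : set T) :
  A #<= [set: U] <-> exists f : T -> U, {in A &, injective f}.
Proof.
rewrite -(card_le_eql (card_setT A)) card_le_typeP.
split=> [[f f_inj]|[f f_inj]]; last first.
  exists (f \o val) => x y /= /f_inj exy; apply/val_inj/exy; exact: valP.
exists (fun x => if pselect (A x) is left Ax then f (SigSub (mem_set Ax)) else u0).
move=> x y; rewrite !inE => Ax Ay.
by case: pselect => // ?; case: pselect => // ? /f_inj [].
Qed.

(** A maximal graph of a partial injection, given by Zorn's lemma, is total or onto: a point missed
    on each side would allow one more pair. *)
Lemma card_le_total (T U : Type) :
  [set: T] #<= [set: U] \/ [set: U] #<= [set: T].
Proof.
pose P := [set G : set (T * U) | forall p q, G p -> G q -> p.1 = q.1 <-> p.2 = q.2].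
have [F FP Ftot|G [GP Gmax]] := @Zorn_bigcup _ P.
  move=> p q [X FX Xp] [Y FY Yq].
  by have [XY|YX] := Ftot _ _ FX FY;
    [apply: (FP _ FY) => //; apply: XY|apply: (FP _ FX) => //; apply: YX].
have [domG|/existsNP[t tG]] := pselect (forall t, exists u, G (t, u)).
  left; apply/card_le_typeP; have [f fG] := choice domG.
  by exists f => x y /(GP _ _ (fG x) (fG y)).
right; apply/card_le_typeP.
have ranG u : exists t, G (t, u).
  apply: contrapT => uG.
  apply: (Gmax (G `|` [set (t, u)])).
    split=> [p Gp|/(_ (t, u))Gtu]; first by left.
    by apply: uG; exists t; apply: Gtu; right.
  move=> [x1 x2] [y1 y2] /= [Gx|[-> ->]] [Gy|[-> ->]] //.
  - exact: (GP _ _ Gx Gy).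
  - by split=> e; [case: tG; exists x2|case: uG; exists x1]; rewrite -e.
  - by split=> e; [case: tG; exists y2|case: uG; exists y1]; rewrite e.
have [f fG] := choice ranG.
by exists f => x y /(GP _ _ (fG x) (fG y)).
Qed.

(* Zorn's lemma yields a maximal [A] with an injection [f : A * A -> A].  If
   the complement of [A] contained a copy of [A], then [f] would extend to the
   union of the two; so [K] is no larger than [A + A], hence than [A * A]. *)
Lemma infinite_card_square (K : Type) :
  infinite_set [set: K] -> [set: K * K] #<= [set: K].
Proof.
move=> /infiniteP/card_le_typeP-[e e_inj].
pose good (p : set K * (K -> K -> K)) := let: (A, f) := p in
  [/\ A (e 0), A (e 1), (forall x y, A x -> A y -> A (f x y)) &
      forall x y x' y', A x -> A y -> A x' -> A y' ->
        f x y = f x' y' -> x = x' /\ y = y'].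
pose T := {p | good p}.
pose le (p q : T) := (sval p).1 `<=` (sval q).1 /\
  forall x y, (sval p).1 x -> (sval p).1 y -> (sval p).2 x y = (sval q).2 x y.
pose R : rel T := fun p q => `[< le p q >].
have Rxx t : R t t by apply/asboolP; split.
have Rtr r s t : R r s -> R s t -> R r t.
  move=> /asboolP[rs rsE] /asboolP[st stE]; apply/asboolP; split.
    exact: subset_trans st.
  by move=> x y rx ry; rewrite rsE// stE//; apply: rs.
have /card_le_typeP[pr pr_inj] : [set: nat * nat] #<= [set: nat].
  exact: (countableP _).
have [d dK] : exists d : K -> nat, forall n, d (e n) = n.
  have /choice[d dP] : forall x, exists n, range e x -> e n = x.
    by move=> x; have [[n _ <-]|ex] := pselect (range e x); [exists n|exists 0].
  by exists d => n; apply/e_inj/dP; exists n.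
(* The starting point is the copy of [nat] in [K], with a pairing function transported along [e]. *)
have t0 : T.
  exists (range e, fun x y => e (pr (d x, d y))); split=> //.
  move=> _ _ _ _ [n _ <-] [m _ <-] [n' _ <-] [m' _ <-].
    by rewrite !dK => /e_inj/pr_inj[-> ->].
have ub (C : set T) : total_on C R -> exists t, forall s, C s -> R s t.
  move=> Ctot; have [[s0 Cs0]|C0] := pselect (C !=set0); last first.
    by exists t0 => s Cs; case: C0; exists s.
  pose A := \bigcup_(s in C) (sval s).1.
  pose dom x y := [set s | [/\ C s, (sval s).1 x & (sval s).1 y]].
  (* [c] picks a member of the chain defined at both arguments; any two such members agree there. *)
  have /choice[c cP] : forall p, exists s, dom p.1 p.2 !=set0 -> dom p.1 p.2 s.
    by move=> p; have [[s sp]|?] := pselect (dom p.1 p.2 !=set0); [exists s|exists s0].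
  pose f x y := (sval (c (x, y))).2 x y.
  have fE s x y : C s -> (sval s).1 x -> (sval s).1 y -> f x y = (sval s).2 x y.
    move=> Cs sx sy; have [|Cs' s'x s'y] := cP (x, y); first by exists s.
    by rewrite /f; have [/asboolP[_ ->]|/asboolP[_ ->]] := Ctot _ _ Cs Cs'.
  have two x y : A x -> A y -> exists s, [/\ C s, (sval s).1 x & (sval s).1 y].
    move=> [s Cs sx] [s' Cs' s'y].
    by have [/asboolP[ss' _]|/asboolP[ss' _]] := Ctot _ _ Cs Cs';
      [exists s'|exists s]; split=> //; apply: ss'.
  have Agood : good (A, f).
    split=> [||x y Ax Ay|x y x' y' Ax Ay Ax' Ay'].
    - by exists s0 => //; case: (s0) => -[? ?] [].
    - by exists s0 => //; case: (s0) => -[? ?] [].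
    - have [s [Cs sx sy]] := two _ _ Ax Ay.
      rewrite (fE s)//; exists s => //; move: sx sy.
      by case: (s) => -[? ?] /= [_ _ + _]; apply.
    have [s [Cs sx sy]] := two _ _ Ax Ay.
    have [s' [Cs' s'x s'y]] := two _ _ Ax' Ay'.
    rewrite (fE s)// (fE s')//.
    have [/asboolP[ss' ->//]|/asboolP[s's ->//]] := Ctot _ _ Cs Cs'.
      move: s'x s'y (ss' _ sx) (ss' _ sy); case: (s') => -[? ?] /= [_ _ _ h] *.
      exact: h.
    move: sx sy (s's _ s'x) (s's _ s'y); case: (s) => -[? ?] /= [_ _ _ h] *.
    exact: h.
  exists (exist _ _ Agood) => s Cs; apply/asboolP; split=> [x sx|x y sx sy] /=.
    by exists s.
  by rewrite (fE s).
have [[[A f] Agood] Amax] := ZL_preorder t0 Rxx Rtr ub.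
have [A0 A1 fA f_inj] := Agood.
have e01 : e 0 <> e 1 by move=> /e_inj.
apply/card_le_typeP.
suff [g g_inj gA] : exists2 g : K -> K, injective g & forall x, A (g x).
  exists (fun p => f (g p.1) (g p.2)) => -[x y] [x' y'] /= /f_inj[] //.
  by move=> /g_inj-> /g_inj->.
have [] := card_le_total (~` A) A; rewrite card_le_typeP => -[h h_inj].
  (* The tags [e 0] and [e 1] keep the image of [A] apart from that of its complement. *)
  pose g x := if pselect (A x) is left Ax then f (e 0) x
              else if pselect ((~` A) x) is left Ax
                then f (e 1) (val (h (SigSub (mem_set Ax)))) else e 0.
  have hA x : A (val (h x)) by have := valP (h x); rewrite inE.
  have gP x : A x /\ g x = f (e 0) x \/
      exists x' : ~` A, x = val x' /\ g x = f (e 1) (val (h x')).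
    rewrite /g; case: pselect => Ax; first by left.
    case: pselect => // A'x; right; by exists (SigSub (mem_set A'x)).
  exists g => [x y|x]; last first.
    by case: (gP x) => [[Ax ->]|[x' [_ ->]]]; apply: fA.
  case: (gP x) => [[Ax ->]|[x' [-> ->]]]; case: (gP y) => [[Ay ->]|[y' [-> ->]]].
  - by move=> /f_inj[].
  - by move=> /f_inj[].
  - by move=> /f_inj[] // /esym.
  - by move=> /f_inj[] // _ /val_inj/h_inj ->.
exfalso.
pose i x := if pselect (A x) is left Ax then val (h (SigSub (mem_set Ax))) else e 0.
have i_inj x y : A x -> A y -> i x = i y -> x = y.
  rewrite /i => Ax Ay; case: pselect => // ?; case: pselect => // ?.
  by move=> /val_inj/h_inj[].
have iA x : A x -> ~ A (i x).
  rewrite /i => Ax; case: pselect => // a.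
  by have := valP (h (SigSub (mem_set a))); rewrite inE.
pose A' := A `|` i @` A.
pose tag x := if `[< A x >] then e 0 else e 1.
have /choice[base baseP] :
    forall x, exists a, A' x -> A a /\ (A x /\ x = a \/ x = i a).
  move=> x; have [[Ax|[a Aa <-]]|A'x] := pselect (A' x); last by exists (e 0).
    by exists x; split=> //; left.
  by exists a; split=> //; right.
have tagA x : A (tag x) by rewrite /tag; case: ifP.
have base_inj x y : A' x -> A' y -> tag x = tag y -> base x = base y -> x = y.
  move=> /baseP[bx hx] /baseP[by_ hy]; rewrite /tag.
  case: asboolP => Ax; case: asboolP => Ay tE exy.
  - case: hx => [[_ ->]|hx]; last by case: (iA _ bx); rewrite -hx.
    case: hy => [[_ ->]|hy]; last by case: (iA _ by_); rewrite -hy.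
    by [].
  - by case: e01.
  - by case: e01.
  - by case: hx => [[]//|->]; case: hy => [[]//|->]; rewrite exy.
(* The new pairs go to the copy of [A] under [i], disjoint from [A], so they never meet a value of
   [f]; [tag] and [base] together determine a point of [A']. *)
pose f' x y := if `[< A x /\ A y >] then f x y
               else i (f (f (tag x) (tag y)) (f (base x) (base y))).
have A'good : good (A', f').
  have codeA x y : A' x -> A' y -> A (f (f (tag x) (tag y)) (f (base x) (base y))).
    by move=> /baseP[bx _] /baseP[by_ _]; apply: (fA); apply: (fA).
  split=> [||x y A'x A'y|x y x' y' A'x A'y A'x' A'y'].
  - by left.
  - by left.
  - rewrite /f'; case: asboolP => [[Ax Ay]|_]; first by left; apply: fA.
    by right; exists (f (f (tag x) (tag y)) (f (base x) (base y))) => //; apply: codeA.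
  rewrite /f'; case: asboolP => [[Ax Ay]|_]; case: asboolP => [[Ax' Ay']|_].
  - exact: f_inj.
  - move=> exy; case: (iA (f (f (tag x') (tag y')) (f (base x') (base y')))).
      exact: codeA.
    by rewrite -exy; apply: fA.
  - move=> exy; case: (iA (f (f (tag x) (tag y)) (f (base x) (base y)))).
      exact: codeA.
    by rewrite exy; apply: fA.
  move=> /(i_inj _ _ (codeA _ _ A'x A'y) (codeA _ _ A'x' A'y')).
  have [[bx _] [by_ _]] := (baseP _ A'x, baseP _ A'y).
  have [[bx' _] [by' _]] := (baseP _ A'x', baseP _ A'y').
  move=> /f_inj[]; [exact: fA..|].
  move=> /f_inj[]// tx ty /f_inj[]// ? ?; split; exact: base_inj.
have /Amax/asboolP[/= A'A _] :
    R (exist _ (A, f) Agood) (exist _ (A', f') A'good).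
  apply/asboolP; split=> /= [x Ax|x y Ax Ay]; first by left.
  by rewrite /f'; case: asboolP => // -[].
by apply: (iA (e 0)) => //; apply: A'A; right; exists (e 0).
Qed.

Lemma bigcup_card_le (K I T : Type) (D : set I) (F : I -> set T) :
  infinite_set [set: K] -> D #<= [set: K] ->
  (forall i, D i -> F i #<= [set: K]) -> \bigcup_(i in D) F i #<= [set: K].
Proof.
move=> K_inf; have [k0 _] := infinite_setN0 K_inf.
have /card_le_typeP[pr pr_inj] := infinite_card_square K K_inf.
move=> /(card_le_setP _ _ k0)[h h_inj] DF.
have /choice[g g_inj] :
    forall i, exists g : T -> K, D i -> {in F i &, injective g}.
  move=> i; have [/DF/(card_le_setP _ _ k0)[g ?]|nDi] := pselect (D i).
    by exists g.
  by exists (fun=> k0).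
have /choice[f fP] : forall x, exists k, (\bigcup_(i in D) F i) x ->
    exists i, [/\ D i, F i x & k = pr (h i, g i x)].
  move=> x; have [[i Di Fix]|Fx] := pselect ((\bigcup_(i in D) F i) x).
    by exists (pr (h i, g i x)) => _; exists i.
  by exists k0.
apply/(card_le_setP _ _ k0); exists f => x y; rewrite !inE.
move=> /fP[i [Di Fix ->]] /fP[j [Dj Fjy ->]] /pr_inj[].
move=> /(h_inj _ _ (mem_set Di) (mem_set Dj)) ij; subst j.
exact: (g_inj _ Di _ _ (mem_set Fix) (mem_set Fjy)).
Qed.

Lemma setU_card_le (K T : Type) (A B : set T) :
  infinite_set [set: K] -> A #<= [set: K] -> B #<= [set: K] ->
  A `|` B #<= [set: K].
Proof.
move=> K_inf AK BK.
have -> : A `|` B = \bigcup_(b in [set: bool]) if b then A else B.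
  apply/seteqP; split=> [x [Ax|Bx]|x [[] _ ?]]; [|by exists false|by left|by right].
  by exists true.
apply: bigcup_card_le => // [|[] //].
by apply: card_le_trans (countableP _) _; apply/infiniteP.
Qed.

(** * Coding bounded initial segments of functions [L -> K] *)

Lemma fun_card_le (K : Type) (dL : Order.disp_t) (L : orderType dL) (i : L) :
  initial_ordinal L -> is_log_succ K L ->
  [set: [set j | j < i]%O -> K] #<= [set: K].
Proof.
move=> [_ Lini] [_ Lmin].
have [//|KM] := card_le_total ([set j | j < i]%O -> K) K.
(* Otherwise minimality would inject [L] into its proper initial segment below [i]. *)
apply: contrapT => MK; apply: (Lini i).
by rewrite -(card_le_eqr (card_setT _)); apply: Lmin.
Qed.

(** By Cantor's diagonal argument [K] itself competes in the minimum defining [L]. *)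
Lemma log_succ_card_le (K L : Type) (k0 k1 : K) :
  k0 <> k1 -> is_log_succ K L -> [set: L] #<= [set: K].
Proof.
move=> k01 [_]; apply; split.
  apply/card_le_typeP; exists (fun k _ => k) => x y /(congr1 (@^~ k0)); exact.
move=> /card_le_typeP[g g_inj].
pose D k := if `[< exists f, g f = k /\ f k = k0 >] then k1 else k0.
suff Dk : D (g D) = k0 <-> D (g D) <> k0 by case: (pselect (D (g D) = k0)); tauto.
rewrite {1}/D; case: asboolP => [[f [/g_inj -> ->]]|nf].
  by split=> // /esym.
by split=> // _ D0; apply: nf; exists D.
Qed.

(* [code i f] determines [i] and the restriction of [f] to the closed initial
   segment [j <= i]; it plays the role of the node [f|(i+1)] of the tree of
   sequences in [K] of length less than [L]. *)
Lemma exists_code (K : Type) (dL : Order.disp_t) (L : orderType dL) :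
  infinite_set [set: K] -> initial_ordinal L -> is_log_succ K L ->
  exists code : L -> (L -> K) -> K, forall i j f g, code i f = code j g ->
    i = j /\ forall k, (k <= i)%O -> f k = g k.
Proof.
move=> K_inf Lini Llog.
have /card_le_typeP[pr pr_inj] := infinite_card_square K K_inf.
have /infiniteP/card_le_typeP-[e e_inj] := K_inf.
have e01 : e 0 <> e 1 by move=> /e_inj.
have /card_le_typeP[h h_inj] := log_succ_card_le _ _ _ _ e01 Llog.
have r (i : L) : {r : ([set j | j < i]%O -> K) -> K | injective r}.
  by apply/cid/card_le_typeP/fun_card_le.
(* [r i] codes restrictions to the strict segment below [i], so [f i] is stored beside it. *)
exists (fun i f => pr (h i, pr (f i, sval (r i) (f \o val)))) => i j f g.
move=> /pr_inj[/h_inj ij]; subst j => /pr_inj[fi /(svalP (r i)) fg]; split=> // k.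
rewrite le_eqVlt => /predU1P[->//|ki].
exact: (congr1 (fun u => u (SigSub (mem_set (ki : [set j | (j < i)%O] k)))) fg).
Qed.

(** * Heights, immediate successors and small sets in trees *)

Section TreeOrder.
Local Open Scope order_scope.

Lemma tree_pred_min (d : Order.disp_t) (S : porderType d) (s x : S)
    (P : set S) :
  is_tree S -> P `<=` tree_pred s -> P x ->
  exists2 z, P z & forall y, P y -> z <= y.
Proof.
move=> tS Ps Px.
have [||z [[Pz zmin] _]] := tS s (mem P).
- by move=> y; rewrite !inE; apply: Ps.
- by exists x; rewrite inE.
exists z => [|y Py]; first by rewrite inE in Pz.
by apply: zmin; rewrite inE.
Qed.

Lemma tree_pred_total (d : Order.disp_t) (S : porderType d) (s x y : S) :
  is_tree S -> x < s -> y < s -> (x <= y) || (y <= x).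
Proof. by move=> tS xs ys; apply: (wo_chainW (tS s)); rewrite inE. Qed.

(** At a least [y] with [f y < y], monotonicity would give [f (f y) < f y]. This rigidity controls
    [tree_succ], which is defined through order types. *)
Lemma tree_pred_self_mono (d : Order.disp_t) (S : porderType d) (s : S)
    (f : tree_pred s -> tree_pred s) :
  is_tree S -> {mono f : x y / ht s x y} -> forall x, ~ (val (f x) < val x).
Proof.
move=> tS f_mono x fx.
have f_lt u v : val u < val v -> val (f u) < val (f v).
  rewrite !lt_leAnge -[val u <= val v]f_mono.
  by rewrite -[val v <= val u]f_mono.
pose P : set S := [set y | exists2 u : tree_pred s, y = val u & val (f u) < val u].
have [||z [u -> fu] zmin] := tree_pred_min _ _ s (val x) P tS.
- by move=> _ [u -> _]; have := valP u; rewrite inE.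
- by exists x.
have /zmin : P (val (f u)) by exists (f u) => //; apply: f_lt.
by move=> /(lt_le_trans fu); rewrite ltxx.
Qed.

(** If [u = s], then [ht s] would be isomorphic to itself with a top added, and embedding it into
    the part below that top would move the top down. *)
Lemma tree_succ_lt (d : Order.disp_t) (S : porderType d) (s u : S) :
  is_tree S -> tree_succ s u -> s < u.
Proof.
move=> tS [su [f [g gK fK] f_mono]]; rewrite lt_neqAle su andbT.
apply/eqP => eq_su; subst u.
have g_mono x y : ht s (g x) (g y) = ord_add (ht s) 1 x y.
  by rewrite -f_mono !fK.
have h_mono : {mono (fun x => g (inl x)) : x y / ht s x y}.
  by move=> x y; rewrite g_mono.
apply: (tree_pred_self_mono _ _ _ _ tS h_mono (g (inr ord0))).
rewrite lt_leAnge; apply/andP; split.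
  by change (ht s (g (inl (g (inr ord0)))) (g (inr ord0))); rewrite g_mono.
by change (~~ (ht s (g (inr ord0)) (g (inl (g (inr ord0)))))); rewrite g_mono.
Qed.

(** Both lie on one branch. For successors [a < b] of [s], an isomorphism of [tree_pred b] onto its
    initial segment [tree_pred a] would move [a] below itself. *)
Lemma tree_succ_unique (d : Order.disp_t) (S : porderType d) (s u v t : S) :
  is_tree S -> tree_succ s u -> tree_succ s v -> u <= t -> v <= t -> u = v.
Proof.
move=> tS.
have not_lt a b : tree_succ s a -> tree_succ s b -> ~ a < b.
  move=> [_ [f [f' fK f'K] f_mono]] [_ [g [g' gK g'K] g_mono]] ab.
  have ltb (x : tree_pred a) : tree_pred b (val x).
    by have := valP x; rewrite inE => xa; apply: lt_trans xa ab.
  pose h (x : tree_pred b) : tree_pred b := SigSub (mem_set (ltb (f' (g x)))).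
  have h_mono : {mono h : x y / ht b x y}.
    move=> x y; rewrite -[RHS]g_mono -[g x]f'K -[g y]f'K f_mono.
    by [].
  apply: (tree_pred_self_mono _ _ _ _ tS h_mono
            (SigSub (mem_set (ab : tree_pred b a)))) => /=.
  by have := valP (f' (g (SigSub (mem_set (ab : tree_pred b a))))); rewrite inE.
move=> su sv ut vt; have /orP[] : (u <= v) || (v <= u).
  have [->|ut'] := eqVneq u t; first by rewrite vt orbT.
  have [->|vt'] := eqVneq v t; first by rewrite ut.
  by apply: (tree_pred_total _ _ t) => //; rewrite lt_neqAle ?ut' ?vt'.
- by rewrite le_eqVlt => /predU1P[//|/(not_lt _ _ su sv)].
- by rewrite le_eqVlt => /predU1P[//|/(not_lt _ _ sv su)].
Qed.

Lemma is_antichain_lt (d : Order.disp_t) (S : porderType d) (X : set S) :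
  (forall x y, X x -> X y -> ~ x < y) -> is_antichain X.
Proof.
move=> Xlt x y Xx Xy /eqP xy; apply/negP.
rewrite /Order.comparable !le_eqVlt (negPf xy) eq_sym (negPf xy) /=.
by move=> /orP[]; apply: Xlt.
Qed.

Lemma card_neq_succ_le (K Kp : Type) (d : Order.disp_t) (S : porderType d)
    (X : set S) :
  is_succ_card K Kp -> [set: S] #= [set: Kp] -> ~ (X #= [set: Kp]) ->
  X #<= [set: K].
Proof.
move=> [_ Kp_min] SKp XKp.
have [|KX] := card_le_total X K; first by rewrite (card_le_eql (card_setT X)).
apply: contrapT => XK; apply: XKp.
rewrite card_eq_le -(card_le_eqr SKp) card_leT /= -(card_le_eqr (card_setT X)).
by apply: Kp_min; split=> //; rewrite (card_le_eql (card_setT X)).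
Qed.

Lemma pair_set_inj (d : Order.disp_t) (S : porderType d) (a b a' b' : S) :
  a < b -> a' < b' -> [set a; b] = [set a'; b'] -> a = a' /\ b = b'.
Proof.
move=> ab ab' E.
have : [set a'; b'] a by rewrite -E; left.
have : [set a'; b'] b by rewrite -E; right.
move=> [eb|eb] [ea|ea] //; move: ab; rewrite ea eb ?ltxx//.
by move=> /(lt_trans ab'); rewrite ltxx.
Qed.
End TreeOrder.

(** * The colouring and its two properties *)

Theorem theorem3p6 (K Kp : Type) (dL : Order.disp_t) (L : orderType dL)
    (dS : Order.disp_t) (S : porderType dS)
    (K_inf : infinite_set [set: K])
    (Kp_succ : is_succ_card K Kp)
    (L_initial : initial_ordinal L)
    (L_log : is_log_succ K L)
    (S_suslin : suslin_tree Kp S)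
    (S_succ : forall s : S, tree_succ s #= [set: K])
    (S_cone : forall s : S, tree_cone s #= [set: Kp]) :
  exists c : comparable_pairs [set: S] -> 'I_2,
    (~ exists X : set S,
         X #= [set: Kp] /\ comparable_pairs X `<=` color_class c 0) /\
    (~ exists (s : S) (B : set S),
         [/\ B `<=` tree_pred s,
             same_order_type (set_le B) (ord_add (<=%O : rel L) 2) &
             comparable_pairs B `<=` color_class c 1]).
Proof.
have [tS SKp S_chain S_anti] := S_suslin.
have [code codeP] := exists_code _ _ _ K_inf L_initial L_log.
have [r r_inj] : exists r : S -> L -> K, injective r.
  apply/card_le_typeP; rewrite (card_le_eql SKp).
  by apply: Kp_succ.2; apply: L_log.1.
have /choice[e eP] : forall s, exists e : K -> S,
    injective e /\ forall k, tree_succ s (e k).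
  move=> s; have : [set: K] #<= [set: tree_succ s].
    by rewrite (card_le_eqr (card_setT _)) (card_le_eqr (S_succ s)).
  move=> /card_le_typeP[e e_inj]; exists (fun k => val (e k)); split.
    by move=> x y /val_inj/e_inj.
  by move=> k; have := valP (e k); rewrite inE.
(* The label is the segment of [r b] up to and including [i], hence [j <= i]. *)
pose Q a b := exists i,
  (e a (code i (r b)) <= b)%O /\ exists2 j, (j <= i)%O & r a j <> r b j.
pose c (p : comparable_pairs [set: S]) : 'I_2 :=
  if `[< exists a b, [/\ (a < b)%O, val p = [set a; b] & Q a b] >]
  then ord_max else ord0.
have cE (Y : set S) n a b : comparable_pairs Y `<=` color_class c n ->
    Y a -> Y b -> (a < b)%O -> n = `[< Q a b >] :> nat.
  move=> Yc Ya Yb ab.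
  have /Yc[p /= <- pE] : comparable_pairs Y [set a; b] by exists a, b.
  rewrite /c; case: asboolP => [[a' [b' [ab' pE' Qab]]]|nQ].
    have [-> ->] : a = a' /\ b = b' by apply: pair_set_inj; rewrite -?pE.
    by rewrite asboolT.
  by rewrite asboolF// => Qab; apply: nQ; exists a, b.
exists c; split; last first.
  move=> [s [B [_ [f [g gK fK] f_mono] Bc]]].
  have gB n : B (val (g n)) by have := valP (g n); rewrite inE.
  have g_mono n m : (val (g n) <= val (g m))%O = ord_add (<=%O : rel L) 2 n m.
    by rewrite -[n in RHS]fK -[m in RHS]fK f_mono.
  have g_lt n m : ord_add (<=%O : rel L) 2 n m && ~~ ord_add (<=%O : rel L) 2 m n ->
      (val (g n) < val (g m))%O.
    by rewrite lt_leAnge !g_mono.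
  (* Of the two top points, [y0] fixes the indices [I n], and a place where [r y0] and [r y1] differ
     bounds them. *)
  pose x n := val (g (inl n)); pose y0 := val (g (inr ord0)).
  pose y1 := val (g (inr ord_max)).
  have xx n m : (n < m)%O -> (x n < x m)%O.
    by move=> nm; apply: g_lt; rewrite /= -lt_leAnge.
  have xy0 n : (x n < y0)%O by apply: g_lt.
  have y01 : (y0 < y1)%O by apply: g_lt.
  have BQ n m : (val (g n) < val (g m))%O -> Q (val (g n)) (val (g m)).
    by move=> /(cE _ _ _ _ Bc (gB _) (gB _)) h; apply/asboolP; move: h; case: asboolP.
  have [I IP] := choice (fun n => BQ _ _ (xy0 n)).
  (* Only one immediate successor of [x n] lies below [y1], so the labels witnessing [Q (x n) y0]
     and [Q (x n) z] coincide. *)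
  have IE n z : (x n < z)%O -> Q (x n) z -> (z <= y1)%O ->
      forall j, (j <= I n)%O -> r y0 j = r z j.
    move=> xz [i [ez _]] zy1; have [ey _] := IP n.
    have [e_inj eS] := eP (x n).
    have /e_inj/codeP[_] : e (x n) (code (I n) (r y0)) = e (x n) (code i (r z)).
      apply: (tree_succ_unique _ _ (x n) _ _ y1) => //.
        exact: le_trans ey (ltW y01).
      exact: le_trans ez zy1.
    exact.
  have [mu ymu] : exists mu, r y0 mu <> r y1 mu.
    by apply/existsNP => /funext/r_inj e01; move: y01; rewrite e01 ltxx.
  have I_mu n : (I n < mu)%O.
    rewrite ltNge; apply/negP => mu_I; apply: ymu; apply: IE mu_I => //.
      exact: lt_trans (xy0 _) y01.
    exact: BQ (lt_trans (xy0 _) y01).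
  (* With [z = x m], equal indices would make [r (x m)] agree with [r y0] up to [I m], against the
     choice of [I m]. *)
  have I_neq n m : (n < m)%O -> I n <> I m.
    move=> nm eI; have [_ [j jI]] := IP m; apply.
    apply/esym; apply: (IE n) => //; [exact: xx|exact/BQ/xx| |by rewrite eI].
    exact/ltW/(lt_trans (xy0 _)).
  apply: (L_initial.2 mu); rewrite -(card_le_eqr (card_setT _)).
  apply/card_le_typeP.
  exists (fun n => SigSub (mem_set (I_mu n : [set i | i < mu]%O (I n)))).
  move=> n m [eI]; have [nm|mn|//] := ltgtP n m.
    by case: (I_neq _ _ nm).
  by case: (I_neq _ _ mn).
move=> [X [XKp Xc]].
have XQ a b : X a -> X b -> (a < b)%O -> ~ Q a b.
  by move=> Xa Xb /(cE _ _ _ _ Xc Xa Xb); case: asboolP.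
have anti_le (Y : set S) : is_antichain Y -> Y #<= [set: K].
  move=> Yanti; apply: (card_neq_succ_le _ _ _ _ _ Kp_succ SKp).
  exact: S_anti.
pose D k := [set s | forall t i, X t -> (s <= t)%O -> k <> code i (r t)].
pose M k := [set s | D k s /\ forall t, (t < s)%O -> ~ D k t].
(* Covering the maximal elements of [X] too ensures that a node of [X] outside [cover] has another
   node of [X] above it. *)
pose top := [set s | X s /\ forall t, X t -> ~ (s < t)%O].
pose cover := \bigcup_(a in top `|` \bigcup_(k in [set: K]) M k)
  [set s | (s <= a)%O].
have cover_le : cover #<= [set: K].
  apply: bigcup_card_le => // [|a _].
    apply: setU_card_le => //.
      by apply/anti_le/is_antichain_lt => x y [_ xtop] [/xtop].
    apply: bigcup_card_le => // k _.
    by apply/anti_le/is_antichain_lt => x y [Dx _] [_ ymin] /ymin.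
  (* The nodes below [a] form a chain. *)
  apply: (card_neq_succ_le _ _ _ _ _ Kp_succ SKp); apply: S_chain.
  move=> x y; rewrite !inE /= => xa ya.
  have [->|xa'] := eqVneq x a; first by rewrite ya orbT.
  have [->|ya'] := eqVneq y a; first by rewrite xa.
  by apply: (tree_pred_total _ _ a) => //; rewrite lt_neqAle ?xa' ?ya'.
have [s [Xs s_cover]] : exists s, X s /\ ~ cover s.
  apply: contrapT => nX; apply: Kp_succ.1.2.
  rewrite -(card_le_eql XKp); apply: card_le_trans cover_le.
  apply: subset_card_le => s Xs; apply: contrapT => ns; apply: nX; by exists s.
have [t [Xt st]] : exists t, X t /\ (s < t)%O.
  apply: contrapT => nt; apply: s_cover; exists s => //=; left; split=> // t Xt st.
  by apply: nt; exists t.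
have [i rsti] : exists i, r s i <> r t i.
  apply/existsNP => /funext/r_inj est; by move: st; rewrite est ltxx.
set k := code i (r t).
have [e_inj eS] := eP s.
have su : (s < e s k)%O by apply: tree_succ_lt.
have nDu : ~ D k (e s k).
  (* A minimal node [a] of [D k] below [e s k] is comparable with [s]: [s <= a] would put [s] in
     [cover], and [a <= s < t] would make [t] refute [D k a]. *)
  move=> Du; have [a Ma au] : exists2 a, M k a & (a <= e s k)%O.
    have [[b [Db bu]]|nb] := pselect (exists b, D k b /\ (b < e s k)%O).
      have [||a [Da au] amin] := tree_pred_min _ _ (e s k) b
        [set b | D k b /\ (b < e s k)%O] tS.
      - by move=> ? [].
      - by [].
      exists a; last exact: ltW.
      split=> // b' b'a Db'; have := lt_le_trans b'a (amin b' _).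
      by rewrite ltxx => /(_ (conj Db' (lt_trans b'a au))).
    exists (e s k) => //; split=> // b bu Db; apply: nb; by exists b.
  have nsa : ~ (s <= a)%O.
    by move=> sa; apply: s_cover; exists a => //; right; exists k.
  have as_ : (a <= s)%O.
    move: au; rewrite le_eqVlt => /predU1P[ea|au].
      by case: nsa; rewrite ea ltW.
    by have /orP[|//] := tree_pred_total _ _ _ _ _ tS su au.
  by case: Ma => /(_ t i Xt) Dt _; apply: Dt; rewrite ?(le_trans as_ (ltW st)).
(* Equal labels force [i' = i] and make [r t'] agree with [r t] up to [i], where [r s] differs. *)
apply: nDu => t' i' Xt' ut' ek.
have st' : (s < t')%O := lt_le_trans su ut'.
apply: (XQ _ _ Xs Xt' st'); exists i'; rewrite -ek; split=> //.
have [<- rE] := codeP _ _ _ _ ek.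
by exists i => //; rewrite -rE.
Qed.
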